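(* Let $m,n\ge 1$. (I) Let $R=(r_1,\dots,r_m)$ and $S=(s_1,\dots,s_n)$ be vectors of nonnegative real numbers with $\sum_i r_i=\sum_j s_j$. Then $\mathcal{T}^{\infty}(R,S)\neq\emptyset$ if and only if (a) $S$ is palindromic, i.e. $s_j=s_{n+1-j}$ for all $j$. (II) Suppose in addition that $R$ and $S$ have nonnegative integer components. Then $\mathcal{T}^{\infty}_{\mathbb{Z}}(R,S)\neq\emptyset$ if and only if (a) holds and (b) if $n$ is even then every component of $R$ is even, and if $n$ is odd then $s_{\lceil n/2\rceil}\ge o(R)$, where $o(R)$ is the number of odd components of $R$.
   Context: $\mathcal{T}(R,S)$ is the set of $m\times n$ matrices with nonnegative real entries whose $i$th row sum is $r_i$ and whose $j$th column sum is $s_j$ for all $i,j$. The reflection $r_\infty$ (in a vertical line) acts on $m\times n$ matrices by $(r_\infty A)_{i,j}=a_{i,\,n+1-j}$. $\mathcal{T}^{\infty}(R,S)$ is the set of $A\in\mathcal{T}(R,S)$ with $r_\infty A=A$; $\mathcal{T}^{\infty}_{\mathbb{Z}}(R,S)$ is the set of those $A\in\mathcal{T}^{\infty}(R,S)$ all of whose entries are integers. *)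

(* Defs.v *)
From mathcomp Require Import all_boot all_order all_algebra.
From mathcomp Require Import boolp classical_sets reals.

Set Implicit Arguments.
Unset Strict Implicit.
Unset Printing Implicit Defensive.

Import Order.TTheory GRing.Theory Num.Theory.

Local Open Scope classical_set_scope.
Local Open Scope ring_scope.

(* Rows and columns are numbered from 0 here, so the 1-based index map
   j |-> n + 1 - j is [rev_ord]. *)

Definition transportation (K : realType) (m n : nat)
    (R : 'rV[K]_m) (S : 'rV[K]_n) : set 'M[K]_(m, n) :=
  [set A | [/\ forall i j, 0 <= A i j,
               forall i, \sum_j A i j = R 0 i
             & forall j, \sum_i A i j = S 0 j]].

Definition vreflect (K : realType) (m n : nat) (A : 'M[K]_(m, n)) :
    'M[K]_(m, n) := \matrix_(i, j) A i (rev_ord j).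

Definition transportation_sym (K : realType) (m n : nat)
    (R : 'rV[K]_m) (S : 'rV[K]_n) : set 'M[K]_(m, n) :=
  [set A | transportation R S A /\ vreflect A = A].

Definition transportation_symZ (K : realType) (m n : nat)
    (R : 'rV[K]_m) (S : 'rV[K]_n) : set 'M[K]_(m, n) :=
  [set A | transportation_sym R S A /\ forall i j, A i j \is a Num.int].

Definition palindromic (K : realType) (n : nat) (S : 'rV[K]_n) : Prop :=
  forall j, S 0 j = S 0 (rev_ord j).

Definition even_real (K : realType) (x : K) : bool := x / 2 \is a Num.int.
Definition odd_real (K : realType) (x : K) : bool := (x - 1) / 2 \is a Num.int.

Definition num_odd (K : realType) (m : nat) (R : 'rV[K]_m) : nat :=
  #|[set i | odd_real (R 0 i)]%SET|.

Lemma mid_ord_subproof (n : nat) : (0 < n -> (uphalf n).-1 < n)%N.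
Proof. by case: n => // n _ /=; rewrite ltnS -{2}(odd_double_half n) -addnn addnA leq_addl. Qed.

(* The 1-based column index is uphalf n, the ceiling of n / 2. *)
Definition mid_ord (n : nat) (n_gt0 : (0 < n)%N) : 'I_n :=
  Ordinal (mid_ord_subproof n_gt0).

(* Main.v *)
(* Over the reals the matrix r_i s_j / N, with N the total sum, is symmetric as
   soon as S is palindromic.  In the integral case, a reflection fixes no column
   but the middle one, so every other column is paired with an equal one and the
   odd units of the row sums sit in the middle column.  Conversely, take a
   nonnegative integral matrix B, zero to the right of the middle, whose row
   sums are the halves of the r_i, rounded down; then B + r_oo B, plus one unit
   in the middle column of each odd row, is symmetric with margins R and S. *)
Require Import Defs.
From mathcomp Require Import all_boot all_order all_algebra.
From mathcomp Require Import boolp classical_sets reals.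
From mathcomp Require Import zify.

Set Implicit Arguments.
Unset Strict Implicit.
Unset Printing Implicit Defensive.

Import Order.TTheory GRing.Theory Num.Theory.

Local Open Scope classical_set_scope.
Local Open Scope ring_scope.

(** Induction on the common total: take one unit off some nonzero [r i0] and one off some nonzero
    [s j0], solve the smaller problem, and put the unit back in the entry [(i0, j0)]. *)
Lemma nat_transportation (I J : finType) (r : I -> nat) (s : J -> nat) :
  (\sum_i r i = \sum_j s j)%N ->
  exists B : I -> J -> nat,
    (forall i, \sum_j B i j = r i)%N /\ (forall j, \sum_i B i j = s j)%N.
Proof.
move: {2}(\sum_i r i)%N (erefl (\sum_i r i)%N) => N.
elim: N r s => [|N IHN] r s.
  move=> r0; rewrite r0 => /esym s0; exists (fun _ _ => 0%N).
  move/eqP: r0; rewrite sum_nat_eq0 => /forallP r0.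
  move/eqP: s0; rewrite sum_nat_eq0 => /forallP s0.
  by split=> [i|j]; rewrite sum_nat_const muln0; apply/esym/eqP; [exact: r0|exact: s0].
(* A family with positive total has a nonzero value at some [x]; lowering that value by one gives
   [g]. *)
have pos (T : finType) (f : T -> nat) : (\sum_x f x = N.+1)%N ->
    exists x, exists2 g : T -> nat,
      (\sum_y g y = N)%N & forall y, f y = (g y + (y == x))%N.
  move=> fN; case: (pickP (fun x => f x != 0%N)) => [x fx0|f0]; last first.
    by move: fN; rewrite big1 // => x _; apply/eqP; rewrite -[_ == _]negbK f0.
  exists x, (fun y => f y - (y == x))%N => [|y].
    move: fN; rewrite (bigD1 x) //= [in X in _ -> X](bigD1 x) //= eqxx.
    rewrite [in X in _ -> X](eq_bigr f) => [|y /negPf ->]; last by rewrite subn0.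
    by case: (f x) fx0 => // k _; rewrite addSn subSS subn0 => -[].
  by case: eqP => [->|_]; rewrite ?subn0 ?addn0 // subnK // lt0n.
move=> rN rs; have sN : (\sum_j s j)%N = N.+1 by rewrite -rs.
have [i0 [r' r'N rE]] := pos _ _ rN; have [j0 [s' s'N sE]] := pos _ _ sN.
have [|B [Br Bs]] := IHN r' s' r'N; first by rewrite r'N s'N.
exists (fun i j => B i j + ((i == i0) && (j == j0)))%N.
split=> [i|j]; rewrite big_split /=.
  rewrite Br rE (bigD1 j0) //= eqxx andbT big1 ?addn0 // => j /negPf ->.
  by rewrite andbF.
by rewrite Bs sE (bigD1 i0) //= eqxx big1 ?addn0 // => i /negPf ->.
Qed.

(** With 0-based indices, a fixed column satisfies [j = n - 1 - j], that is [2 j + 1 = n]. *)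
Lemma eq_rev_ord (n : nat) (n_gt0 : (0 < n)%N) (j : 'I_n) :
  (j == rev_ord j) = odd n && (j == mid_ord n_gt0).
Proof.
rewrite -!val_eqE /= uphalf_half; have := odd_double_half n; have := ltn_ord j.
by case: (odd n) => /=; lia.
Qed.

Lemma sum_rev_ord_fixed (n : nat) (n_gt0 : (0 < n)%N) (f : 'I_n -> nat) :
  (\sum_(j | j == rev_ord j) f j = if odd n then f (mid_ord n_gt0) else 0)%N.
Proof.
under eq_bigl do rewrite (eq_rev_ord n_gt0).
by case: (odd n); rewrite ?big_pred1_eq ?big_pred0_eq.
Qed.

(** The reflection carries the columns right of the middle bijectively onto those left of it, so the
    two halves contribute equally and only a fixed column remains. *)
Lemma sum_rev_ord (n : nat) (n_gt0 : (0 < n)%N) (f : 'I_n -> nat) :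
  (forall j, f (rev_ord j) = f j) ->
  (\sum_j f j = (\sum_(j < n | (j < rev_ord j)%N) f j).*2
                + if odd n then f (mid_ord n_gt0) else 0)%N.
Proof.
move=> f_sym; rewrite -(sum_rev_ord_fixed n_gt0).
rewrite (bigID (fun j : 'I_n => (j < rev_ord j)%N)) /= -addnn -addnA; congr addn.
rewrite (bigID (fun j : 'I_n => j == rev_ord j)) /= addnC; congr addn.
  rewrite (reindex_inj rev_ord_inj) /=; apply: eq_big => [j|j _]; last exact: f_sym.
  by rewrite rev_ordK -!val_eqE /=; have := ltn_ord j; lia.
by apply: eq_bigl => j; rewrite -val_eqE /=; lia.
Qed.

Lemma even_real_nat (K : realType) (k : nat) : even_real (k%:R : K) = ~~ odd k.
Proof.
have two0 : (2 : K) != 0 by rewrite pnatr_eq0.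
apply/idP/idP => [/intrP[z zE]|/even_halfK <-].
  have : (k%:Z)%:~R = (z * 2)%:~R :> K.
    by rewrite intrM -zE mulfVK.
  by move/intr_inj; lia.
by rewrite /even_real -mul2n natrM mulrC mulKf // intr_nat.
Qed.

Lemma odd_real_nat (K : realType) (k : nat) : odd_real (k%:R : K) = odd k.
Proof.
have two0 : (2 : K) != 0 by rewrite pnatr_eq0.
apply/idP/idP => [/intrP[z zE]|ok].
  have : (k%:Z)%:~R = (z * 2 + 1)%:~R :> K.
    by rewrite intrD intrM -zE mulfVK // subrK.
  by move/intr_inj; lia.
rewrite /odd_real -[k]odd_double_half ok natrD [1%:R + _]addrC addrK.
by rewrite -mul2n natrM mulrC mulKf // intr_nat.
Qed.

Lemma num_odd_nat (K : realType) (m : nat) (R : 'rV[K]_m) (r : 'I_m -> nat) :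
  (forall i, R 0 i = (r i)%:R) -> num_odd R = (\sum_i odd (r i))%N.
Proof.
move=> RE; rewrite /num_odd -sum1dep_card big_mkcond; apply: eq_bigr => i _.
by rewrite RE odd_real_nat; case: odd.
Qed.

Lemma nat_valued (K : realType) (T : Type) (f : T -> K) :
  (forall x, 0 <= f x) -> (forall x, f x \is a Num.int) ->
  exists g : T -> nat, forall x, f x = (g x)%:R.
Proof.
move=> f_ge0 f_int; exists (fun x => Num.truncn (f x)) => x.
by rewrite truncnK // natrEint f_int f_ge0.
Qed.

Lemma palindromic_sym (K : realType) (m n : nat) (R : 'rV[K]_m) (S : 'rV[K]_n)
    (A : 'M[K]_(m, n)) :
  transportation_sym R S A -> palindromic S.
Proof.
move=> [[_ _ AS] Asym] j; rewrite -!AS; apply: eq_bigr => i _.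
by rewrite -{1}Asym mxE.
Qed.

Lemma product_transportation_sym (K : realType) (m n : nat)
    (R : 'rV[K]_m) (S : 'rV[K]_n) :
  (forall i, 0 <= R 0 i) -> (forall j, 0 <= S 0 j) ->
  \sum_i R 0 i = \sum_j S 0 j -> palindromic S ->
  transportation_sym R S (\matrix_(i, j) (R 0 i * S 0 j / \sum_i R 0 i)).
Proof.
move=> R_ge0 S_ge0 sumRS S_pal; set N := \sum_i R 0 i.
(* When [N = 0], division by zero returns 0 and the matrix vanishes; its margins are still right,
   because nonnegative entries with sum 0 are all 0. *)
have null k (v : 'rV[K]_k) : (forall i, 0 <= v 0 i) -> \sum_i v 0 i = N ->
    N = 0 -> forall i, v 0 i = 0.
  move=> v_ge0 vN N0 i; move/eqP: vN; rewrite N0 psumr_eq0 // => /allP.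
  by move=> /(_ i (mem_index_enum i)) /eqP.
split; last by apply/matrixP => i j; rewrite !mxE -S_pal.
split=> [i j|i|j].
- by rewrite mxE divr_ge0 ?mulr_ge0 // sumr_ge0.
- under eq_bigr do rewrite mxE mulrAC.
  rewrite -mulr_sumr -sumRS -/N; have [N0|N0] := eqVneq N 0.
    by rewrite N0 mulr0 (null _ R).
  by rewrite mulfVK.
- under eq_bigr do rewrite mxE -mulrA.
  rewrite -mulr_suml -/N; have [N0|N0] := eqVneq N 0.
    by rewrite N0 mul0r (null _ S).
  by rewrite mulrC mulfVK.
Qed.

(** In a symmetric row the off-middle entries add up to an even number. Hence for even [n] the row
    sum is even, and for odd [n] an odd row sum forces an odd, so positive, middle entry; summing
    the middle column over the rows bounds the number of odd rows. *)
Lemma transportation_symZ_parity (K : realType) (m n : nat)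
    (n_gt0 : (0 < n)%N) (R : 'rV[K]_m) (S : 'rV[K]_n) (A : 'M[K]_(m, n)) :
  transportation_symZ R S A ->
  (~~ odd n -> forall i, even_real (R 0 i)) /\
  (odd n -> (num_odd R)%:R <= S 0 (mid_ord n_gt0)).
Proof.
move=> [[[A_ge0 AR AS] Asym] AZ].
have [a aE] := nat_valued (fun p => A_ge0 p.1 p.2) (fun p => AZ p.1 p.2).
have a_sym i j : a (i, rev_ord j) = a (i, j).
  by apply/eqP; rewrite -(eqr_nat K) -!aE /= -[in X in _ == X]Asym mxE.
have RE i : R 0 i = (\sum_j a (i, j))%:R.
  by rewrite -AR natr_sum; apply: eq_bigr => j _; rewrite -aE.
have SE : S 0 (mid_ord n_gt0) = (\sum_i a (i, mid_ord n_gt0))%:R.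
  by rewrite -AS natr_sum; apply: eq_bigr => i _; rewrite -aE.
split=> n_odd => [i|].
  rewrite RE even_real_nat (sum_rev_ord n_gt0) // (negPf n_odd).
  by rewrite addn0 odd_double.
rewrite (num_odd_nat RE) SE ler_nat leq_sum // => i _.
rewrite (sum_rev_ord n_gt0) // n_odd oddD odd_double addFb.
by case: (a _) => //= k; case: odd.
Qed.

Lemma transportation_symZ_exists (K : realType) (m n : nat)
    (n_gt0 : (0 < n)%N) (R : 'rV[K]_m) (S : 'rV[K]_n) :
  (forall i, 0 <= R 0 i) -> (forall j, 0 <= S 0 j) ->
  \sum_i R 0 i = \sum_j S 0 j ->
  (forall i, R 0 i \is a Num.int) -> (forall j, S 0 j \is a Num.int) ->
  palindromic S ->
  (~~ odd n -> forall i, even_real (R 0 i)) ->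
  (odd n -> (num_odd R)%:R <= S 0 (mid_ord n_gt0)) ->
  transportation_symZ R S !=set0.
Proof.
move=> R_ge0 S_ge0 sumRS RZ SZ S_pal R_even S_mid.
have [r rE] := nat_valued R_ge0 RZ; have [s sE] := nat_valued S_ge0 SZ.
have s_sym j : s (rev_ord j) = s j.
  by apply/eqP; rewrite -(eqr_nat K) -!sE -S_pal.
set o := (\sum_i odd (r i))%N; set mid := mid_ord n_gt0.
have r_even i : ~~ odd n -> odd (r i) = false.
  by move=> /R_even/(_ i); rewrite rE even_real_nat => /negPf.
have o_mid : odd n -> (o <= s mid)%N.
  by move=> /S_mid; rewrite (num_odd_nat rE) sE ler_nat.
have o_even : ~~ odd n -> o = 0%N.
  by move=> n_even; rewrite /o big1 // => i _; rewrite r_even.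
pose H := (\sum_i (r i)./2)%N; pose P := (\sum_(j < n | (j < rev_ord j)%N) s j)%N.
(* The total is counted twice: by rows, each [r i] being its parity plus twice its half, and by
   columns, paired by the reflection. The two counts are compared in [K], where the hypothesis on
   the totals lives. *)
have HP : (o + H.*2 = P.*2 + if odd n then s mid else 0)%N.
  rewrite -(sum_rev_ord n_gt0) // -muln2 big_distrl -big_split /=.
  apply/eqP; rewrite -(eqr_nat K) !natr_sum.
  rewrite -(eq_bigr _ (fun j _ => sE j)) -sumRS; apply/eqP/eq_bigr => i _.
  by rewrite muln2 odd_double_half rE.
(* These are the column sums intended for [B]. By [HP] the middle one, [H - P], is half of
   [s mid - o]; the subtraction is not truncated, since [o <= s mid] gives [P <= H]. *)
pose t (j : 'I_n) := (if (j < rev_ord j)%N then s j else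
  if j == rev_ord j then H - P else 0)%N.
have tE j : (t j + t (rev_ord j) + (j == rev_ord j) * o = s j)%N.
  rewrite /t rev_ordK [rev_ord j == j]eq_sym s_sym.
  case: (ltngtP j (rev_ord j)) => [lt_j|lt_j|/val_inj eq_j].
  - by rewrite -val_eqE ltn_eqF // !addn0.
  - by rewrite -val_eqE gtn_eqF // addn0.
  - have := eq_rev_ord n_gt0 j; rewrite -eq_j eqxx => /esym/andP[n_odd /eqP ->].
    by move: HP (o_mid n_odd); rewrite n_odd -/mid; lia.
(* The totals agree: the columns of [t] sum to [P] plus, for odd [n], [H - P]; for even [n], [o = 0]
   and [HP] give [H = P]. *)
have [|B [Br Bs]] := @nat_transportation _ _ (fun i => (r i)./2) t.
  rewrite -/H /t (bigID (fun j : 'I_n => (j < rev_ord j)%N)) /=.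
  rewrite (eq_bigr s) => [|j ->] //; rewrite -/P.
  rewrite (eq_bigr (fun j => if j == rev_ord j then H - P else 0)%N); last first.
    by move=> j /negPf ->.
  rewrite -big_mkcondr /= (eq_bigl (fun j => j == rev_ord j)); last first.
    by move=> j; rewrite -val_eqE /=; lia.
  rewrite (sum_rev_ord_fixed n_gt0); move: HP o_mid o_even.
  by case: (odd n) => HP o_mid o_even; [have := o_mid isT|have := o_even isT]; lia.
pose a i j := (B i j + B i (rev_ord j) + (j == rev_ord j) * odd (r i))%N.
exists (\matrix_(i, j) (a i j)%:R); split; last by move=> i j; rewrite mxE intr_nat.
split; last first.
  apply/matrixP => i j; rewrite !mxE /a rev_ordK [rev_ord j == j]eq_sym.
  by rewrite [(B i (rev_ord j) + _)%N]addnC.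
split=> [i j|i|j]; first by rewrite mxE ler0n.
- under eq_bigr do rewrite mxE.
  have Brev : (\sum_j B i (rev_ord j) = (r i)./2)%N.
    by rewrite -Br [RHS](reindex_inj rev_ord_inj).
  rewrite rE -natr_sum !big_split /= Br Brev.
  congr _%:R; rewrite -big_distrl /= big_mkcond /=.
  (* The number of fixed columns is 1 or 0 with the parity of [n]. So the parity of [r i] is
     restored once for odd [n], and for even [n] there is none to restore. *)
  have -> : (\sum_(j < n) (j == rev_ord j) = odd n)%N.
    transitivity (\sum_(j < n | j == rev_ord j) 1)%N.
      by rewrite [RHS]big_mkcond; apply: eq_bigr => j _; case: eqP.
    by rewrite (sum_rev_ord_fixed n_gt0); case: odd.
  have := odd_double_half (r i); have := r_even i.
  by case: (odd n) => [_|->] //; lia.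
- under eq_bigr do rewrite mxE.
  by rewrite sE -natr_sum !big_split /= !Bs -big_distrr /= -/o tE.
Qed.

Theorem theorem9 (K : realType) (m n : nat)
    (m_gt0 : (0 < m)%N) (n_gt0 : (0 < n)%N)
    (R : 'rV[K]_m) (S : 'rV[K]_n)
    (R_ge0 : forall i, 0 <= R 0 i) (S_ge0 : forall j, 0 <= S 0 j)
    (sumRS : \sum_i R 0 i = \sum_j S 0 j) :
  (transportation_sym R S !=set0 <-> palindromic S)
  /\
  ((forall i, R 0 i \is a Num.int) -> (forall j, S 0 j \is a Num.int) ->
   (transportation_symZ R S !=set0 <->
      palindromic S /\
      ((~~ odd n -> forall i, even_real (R 0 i)) /\
       (odd n -> (num_odd R)%:R <= S 0 (mid_ord n_gt0))))).

Proof.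
split=> [|RZ SZ]; split.
- by move=> [A]; exact: palindromic_sym.
- by move=> S_pal; eexists; exact: product_transportation_sym.
- move=> [A AZ]; split; first exact: palindromic_sym AZ.1.
  exact: transportation_symZ_parity AZ.
- by move=> [S_pal [R_even S_mid]]; exact: transportation_symZ_exists S_mid.
Qed.
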